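(* Let $\mathbb{F}$ be a field, let $X=\{x_1,\ldots,x_n\}$ and $Z=\{z_1,\ldots,z_n\}$ be sets of variables, and let $R = \mathbb{F}\langle Z \rangle$. Let $f(x_1,\ldots,x_n) \in \mathbb{F}\langle X \rangle$. Suppose there exists an arithmetic circuit with set of input variables $X$ over the ring $R$ that computes $f(x_1,\ldots,x_n)$ as a function from $R^n$ to $R$. Then there exists a non-commutative arithmetic circuit over the field $\mathbb{F}$ computing the non-commutative polynomial $f$ that has the same number of sum gates, the same number of product gates, the same size and the same depth.
   Context: For a set of variables $Y$, $\mathbb{F}\langle Y\rangle$ is the ring of non-commutative polynomials over $\mathbb{F}$ in the non-commuting variables of $Y$ (formal $\mathbb{F}$-linear combinations of words over $Y$, product = concatenation extended bilinearly). An arithmetic circuit over a ring $S$ with input variables $x_1,\dots,x_n$ is a finite directed acyclic graph whose in-degree-0 nodes (leaves) are labeled by an input variable or an element of $S$, whose other nodes are labeled $+$ (sum gates, arbitrary positive in-degree) or $\times$ (product gates, in-degree exactly 2, with an ordered left and right child), with a designated output node (the unique node of out-degree 0). Its size is the number of edges and its depth is the length of the longest directed path from a leaf to the output. Over a ring $R$, each node computes a function $R^n\to R$: a leaf labeled $x_i$ returns the $i$-th coordinate, a leaf labeled by a ring element returns that element, a sum gate returns the sum of its children's values, and a product gate returns (left child's value)$\cdot$(right child's value) in that order; the circuit computes the function at the output node. A non-commutative arithmetic circuit over a field $\mathbb{F}$ has leaves labeled by input variables or field elements, and each node computes an element of $\mathbb{F}\langle X\rangle$ in the analogous way (product gates multiply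 left times right); it computes the polynomial at its output node. *)

(* Defs.v *)
From HB Require Import structures.
From mathcomp Require Import all_boot all_algebra.
From mathcomp.multinomials Require Import monalg.

Set Implicit Arguments.
Unset Strict Implicit.
Unset Printing Implicit Defensive.

Import GRing.Theory.
Local Open Scope ring_scope.

(* F<y_1, ..., y_n>: the monoid algebra over F of the free monoid on 'I_n. *)
Notation "{ 'ncpoly' F [ n ] }" := {malg F[{fmonom 'I_n}]}
  (at level 0, F, n at level 2, format "{ 'ncpoly'  F [ n ] }") : type_scope.

Definition ncvar (F : fieldType) (n : nat) (i : 'I_n) : {ncpoly F[n]} :=
  << fmu i >>.

(* f(r_1, ..., r_n) for r_i in F<z_1, ..., z_m>; factors are multiplied in the
   order of the letters of each word of f. *)
Definition ncsubst (F : fieldType) (n m : nat)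
    (f : {ncpoly F[n]}) (r : 'I_n -> {ncpoly F[m]}) : {ncpoly F[m]} :=
  mmap (fun c : F => c%:MP) (fun w : {fmonom 'I_n} => \prod_(i <- w) r i) f.

(* Sum and Prod carry the children of the gate, i.e. its incoming edges.  The
   graph may have parallel edges (as for squaring by one product gate); the
   order of the list in Sum is immaterial. *)
Inductive gate (n : nat) (S V : Type) : Type :=
  | Input of 'I_n
  | Const of S
  | Sum of seq V
  | Prod of V & V.

Arguments Input {n S V} _.
Arguments Const {n S V} _.
Arguments Sum {n S V} _.
Arguments Prod {n S V} _ _.

Section Gate.
Context (n : nat) (S V : Type).
Implicit Type g : gate n S V.

Definition children g : seq V :=
  match g with
  | Input _ | Const _ => [::]
  | Sum s => s
  | Prod u w => [:: u; w]
  end.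

Definition is_leaf g : bool :=
  match g with Input _ | Const _ => true | _ => false end.
Definition is_sum g : bool := if g is Sum _ then true else false.
Definition is_prod g : bool := if g is Prod _ _ then true else false.

End Gate.

Record circuit (n : nat) (S : Type) : Type := Circuit {
  node :> finType;
  label : node -> gate n S node;
  output : node;
  sum_children : forall v s, label v = Sum s -> s <> [::];
  acyclic : forall c : seq node,
    cycle (fun u v => u \in children (label v)) c -> c = [::];
  outputP : forall v,
    (forall w, v \notin children (label w)) <-> v = output
}.

Section Circuit.
Context (n : nat) (S : Type) (C : circuit n S).
Implicit Types (u v w : C) (p : seq C).

Definition edge : rel C := fun u v => u \in children (label v).

Definition num_sums : nat := #|[pred v : C | is_sum (label v)]|.
Definition num_prods : nat := #|[pred v : C | is_prod (label v)]|.

Definition circuit_size : nat := (\sum_(v : C) size (children (label v)))%N.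

Definition leaf_output_path u p : bool :=
  [&& is_leaf (label u), path edge u p & last u p == output C].

(* The bound on k only makes the maximum finite: see leaf_output_path_depth and
   depth_attained. *)
Definition circuit_depth : nat :=
  (\max_(k < #|C| | [exists u : C, exists p : k.-tuple C, leaf_output_path u p])
     k)%N.

(* Evaluation at inputs inp in a ring A, with constants read in A by cst.  The
   fuel k makes the recursion structural; #|C| always suffices, see evalE. *)
Section Eval.
Context (A : pzRingType) (cst : S -> A) (inp : 'I_n -> A).

Fixpoint eval_upto (k : nat) (v : C) : A :=
  if k is k'.+1 then
    match label v with
    | Input i => inp i
    | Const c => cst c
    | Sum s => \sum_(u <- s) eval_upto k' u
    | Prod u w => eval_upto k' u * eval_upto k' w
    end
  else 0.

Definition eval (v : C) : A := eval_upto #|C| v.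

End Eval.

Lemma edge_path_uniq u p : path edge u p -> uniq (u :: p).
Proof.
elim: p u => [|v p IHp] u //= /andP[uv vp]; rewrite -/(uniq (v :: p)).
have /= -> := IHp v vp; rewrite andbT; apply/negP => u_vp.
have {uv vp} : path edge u (v :: p) by rewrite /= uv.
case/splitPr: u_vp => p1 p2; rewrite cat_path /= => /and3P[up1 lu _].
suff: u :: p1 = [::] by [].
by apply: acyclic; rewrite /= rcons_path; apply/andP; split.
Qed.

Lemma edge_path_size u p : path edge u p -> (size p < #|C|)%N.
Proof. by move/edge_path_uniq/card_uniqP => /= <-; apply: max_card. Qed.

Lemma leaf_output_path_depth u p :
  leaf_output_path u p -> (size p <= circuit_depth)%N.
Proof.
move=> up; have /and3P[_ /edge_path_size lt_p _] := up.
apply: (leq_bigmax_cond (Ordinal lt_p)).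
by apply/existsP; exists u; apply/existsP; exists (in_tuple p).
Qed.

Lemma depth_attained : exists u p,
  leaf_output_path u p /\ size p = circuit_depth.
Proof.
have reach k : (exists u p, leaf_output_path u p) \/
    exists u p, [/\ path edge u p, last u p = output C & size p = k].
  elim: k => [|k [|[u [p [up lp <-]]]]]; [|by left|].
    by right; exists (output C), [::].
  case Dg: (label u) => [i|c|s|v w].
  - by left; exists u, p; rewrite /leaf_output_path Dg up lp eqxx.
  - by left; exists u, p; rewrite /leaf_output_path Dg up lp eqxx.
  - case: s Dg => [|v s] Dg; first by case: (sum_children Dg).
    by right; exists v, (u :: p); rewrite /= up /edge Dg mem_head.
  - by right; exists v, (u :: p); rewrite /= up /edge Dg mem_head.
have [u0 [p0 up0]] : exists u p, leaf_output_path u p.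
  case: (reach #|C|) => // -[u [p [/edge_path_size lt_p _ Dp]]].
  by rewrite Dp ltnn in lt_p.
have /and3P[_ /edge_path_size lt_p _] := up0.
have [|k /existsP[u /existsP[p up]] Dk] := @eq_bigmax_cond _
  [pred k : 'I_#|C| | [exists u : C, exists p : k.-tuple C,
    leaf_output_path u p]] (fun k => k : nat).
  apply/card_gt0P; exists (Ordinal lt_p); apply/existsP; exists u0.
  by apply/existsP; exists (in_tuple p0).
by exists u, p; split=> //; rewrite size_tuple -Dk; apply: eq_bigl.
Qed.

Lemma evalE (A : pzRingType) (cst : S -> A) (inp : 'I_n -> A) v :
  eval cst inp v =
    match label v with
    | Input i => inp i
    | Const c => cst c
    | Sum s => \sum_(u <- s) eval cst inp u
    | Prod u w => eval cst inp u * eval cst inp w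
    end.
Proof.
have stable k w :
    (forall u p, path edge u p -> last u p = w -> (size p < k)%N) ->
  eval_upto cst inp k.+1 w = eval_upto cst inp k w.
  elim: k w => [|k IHk] w hw; first by have := hw w [::] isT erefl.
  have IHw u : u \in children (label w) ->
      eval_upto cst inp k.+1 u = eval_upto cst inp k u.
    move=> uw; apply: IHk => t p tp lp; rewrite -ltnS -(size_rcons p w).
    by apply: (hw t); rewrite ?last_rcons // rcons_path tp lp.
  rewrite [LHS]/= [RHS]/=; case Dg: (label w) IHw => [i|c|s|u1 u2] //= IHw.
    by apply: eq_big_seq => u /IHw.
  by rewrite -!IHw ?inE ?eqxx ?orbT.
have -> : eval cst inp v = eval_upto cst inp #|C|.+1 v.
  by rewrite stable // => u p /edge_path_size.
by [].
Qed.

End Circuit.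

Definition circuit_fun (n : nat) (R : pzRingType) (C : circuit n R)
    (x : 'I_n -> R) : R :=
  eval id x (output C).

Definition circuit_poly (n : nat) (F : fieldType) (C : circuit n F) :
    {ncpoly F[n]} :=
  eval (fun c : F => c%:MP) (@ncvar F n) (output C).

(* Main.v *)
Require Import Defs.
From HB Require Import structures.
From mathcomp Require Import all_boot all_algebra finmap.
From mathcomp.multinomials Require Import monalg.

(* Adjoin the inputs as new free letters: the circuit computes an element P of
   F<Z, X>, and D := P - f(X) vanishes when each x_i is replaced by any element
   of F<Z>.  Replace x_i by z_i^N with N larger than the length of every word
   of D: a word with k letters in X and l < N letters in Z becomes a word of
   length k N + l, so the image of a word in X alone is shared by no other word
   of D, and D has no word in X alone.  Hence D vanishes at Z = 0, that is,
   replacing each constant of the circuit by its constant term yields a circuit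
   over F computing f. *)

Set Implicit Arguments.
Unset Strict Implicit.
Unset Printing Implicit Defensive.

Import GRing.Theory.
Local Open Scope ring_scope.

(** * Relabelling the constants of a circuit *)

Section MapCircuit.
Context (n : nat) (S T : Type) (g : S -> T).

Definition map_gate (V : Type) (a : gate n S V) : gate n T V :=
  match a with
  | Input i => Input i
  | Const c => Const (g c)
  | Sum s => Sum s
  | Prod u w => Prod u w
  end.

Lemma children_map_gate V (a : gate n S V) :
  children (map_gate a) = children a.
Proof. by case: a. Qed.

Lemma is_leaf_map_gate V (a : gate n S V) : is_leaf (map_gate a) = is_leaf a.
Proof. by case: a. Qed.

Lemma is_sum_map_gate V (a : gate n S V) : is_sum (map_gate a) = is_sum a.
Proof. by case: a. Qed.

Lemma is_prod_map_gate V (a : gate n S V) : is_prod (map_gate a) = is_prod a.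
Proof. by case: a. Qed.

Variable C : circuit n S.

Fact map_sum_children (v : C) s : map_gate (label v) = Sum s -> s <> [::].
Proof. by case Dv: (label v) => // -[<-]; apply: sum_children Dv. Qed.

Fact map_acyclic (c : seq C) :
  cycle (fun u v => u \in children (map_gate (label v))) c -> c = [::].
Proof.
move=> cyc; apply: acyclic; apply: etrans cyc; apply: eq_cycle => u v.
by rewrite children_map_gate.
Qed.

Fact map_outputP (v : C) :
  (forall w, v \notin children (map_gate (label w))) <-> v = output C.
Proof.
rewrite -outputP; split=> noedge w; have := noedge w;
  by rewrite children_map_gate.
Qed.

Definition map_circuit : circuit n T :=
  Circuit map_sum_children map_acyclic map_outputP.

Lemma num_sums_map : num_sums map_circuit = num_sums C.
Proof. by apply: eq_card => v; rewrite !inE is_sum_map_gate. Qed.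

Lemma num_prods_map : num_prods map_circuit = num_prods C.
Proof. by apply: eq_card => v; rewrite !inE is_prod_map_gate. Qed.

Lemma circuit_size_map : circuit_size map_circuit = circuit_size C.
Proof. by apply: eq_bigr => v _; rewrite children_map_gate. Qed.

Lemma circuit_depth_map : circuit_depth map_circuit = circuit_depth C.
Proof.
apply: eq_bigl => k; apply: eq_existsb => u; apply: eq_existsb => p.
rewrite /leaf_output_path is_leaf_map_gate; congr [&& _, _ & _].
by apply: eq_path => v w; rewrite /edge children_map_gate.
Qed.

Lemma eval_map (A : pzRingType) (cst : T -> A) inp (v : C) :
  eval (C := map_circuit) cst inp v = eval (cst \o g) inp v.
Proof.
rewrite /eval; elim: #|C| v => //= k IHk v.
case: (label v) => //= [s|u w]; last by rewrite !IHk.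
by apply: eq_bigr => u _; rewrite IHk.
Qed.

End MapCircuit.

(** * Evaluation under ring homomorphisms *)

Section Eval.
Context (n : nat) (S : Type) (C : circuit n S) (A B : pzRingType).
Context (h : {rmorphism A -> B}).

Lemma rmorph_eval (cst : S -> A) inp (v : C) :
  h (eval cst inp v) = eval (h \o cst) (h \o inp) v.
Proof.
rewrite /eval; elim: #|C| v => [|k IHk] v /=; first by rewrite rmorph0.
case: (label v) => //= [s|u w]; last by rewrite rmorphM !IHk.
by rewrite rmorph_sum; apply: eq_bigr.
Qed.

Lemma eq_eval (cst cst' : S -> A) inp inp' (v : C) :
  cst =1 cst' -> inp =1 inp' -> eval cst inp v = eval cst' inp' v.
Proof.
move=> eq_cst eq_inp; rewrite /eval; elim: #|C| v => //= k IHk v.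
case: (label v) => //= [s|u w]; last by rewrite !IHk.
by apply: eq_bigr.
Qed.

End Eval.

(** * Substitution homomorphisms between free algebras *)

Section Subst.
Context (F : fieldType).

(** Scalars are central even though the algebra is not commutative; this is the commutation
    condition under which [mmap] is multiplicative. *)
Lemma malgC_comm (K : monomType) (c : F) (f : {malg F[K]}) :
  GRing.comm c%:MP f.
Proof.
rewrite /GRing.comm mul_malgC malgZ_def malgM_def fgmulgU; apply: eq_bigr => k _.
by rewrite mulm1 mulrC.
Qed.

Section Word.
Context (I J : choiceType) (r : I -> {malg F[{fmonom J}]}).

Definition word_eval (w : {fmonom I}) : {malg F[{fmonom J}]} :=
  \prod_(i <- w) r i.

Fact word_eval_multiplicative : mmorphism word_eval.
Proof.
split=> [u w|]; first by rewrite /word_eval fmM big_cat.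
by rewrite /word_eval fm1 big_nil.
Qed.

HB.instance Definition _ :=
  isMultiplicative.Build _ _ word_eval word_eval_multiplicative.

(** Convertible to [ncsubst] on finite ordinals; arbitrary alphabets allow the disjoint union of Z
    and X. *)
Definition subst (f : {malg F[{fmonom I}]}) : {malg F[{fmonom J}]} :=
  mmap (fun c : F => c%:MP) word_eval f.

HB.instance Definition _ := GRing.Additive.copy subst
  (mmap (@malgC {fmonom J} F) word_eval).

HB.instance Definition _ :=
  GRing.isMultiplicative.Build _ _ subst
    (commr_mmap_is_multiplicative (fun f m m' => malgC_comm f@_m (word_eval m'))).

Lemma substC c : subst c%:MP = c%:MP.
Proof. exact: mmapC. Qed.

Lemma substE f : subst f = \sum_(w <- msupp f) f@_w *: word_eval w.
Proof. by apply: eq_bigr => w _; rewrite mul_malgC. Qed.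

Lemma substX i : subst << fmu i >> = r i.
Proof. by rewrite /subst mmapU /word_eval fmU big_seq1 mul_malgC scale1r. Qed.

End Word.

Lemma subst_comp (I J K : choiceType) (r : J -> {malg F[{fmonom K}]})
    (s : I -> {malg F[{fmonom J}]}) f :
  subst r (subst s f) = subst (subst r \o s) f.
Proof.
rewrite [subst s f]/subst /mmap rmorph_sum; apply: eq_bigr => w _ /=.
by rewrite rmorphM /= substC rmorph_prod.
Qed.

Lemma subst_ext (I J : choiceType) (r s : I -> {malg F[{fmonom J}]}) f :
  r =1 s -> subst r f = subst s f.
Proof.
by move=> rs; apply: eq_bigr => w _; congr (_ * _); apply: eq_bigr.
Qed.

Lemma subst_eq0 (I J : choiceType) (r : I -> {malg F[{fmonom J}]}) f :
  (forall w, w \in msupp f -> word_eval r w = 0) -> subst r f = 0.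
Proof.
by move=> r0; rewrite substE big_seq big1 // => w /r0 ->; rewrite scaler0.
Qed.

(** Every nonempty word acquires a factor 0. This identifies setting Z = 0 in a constant of the
    circuit with [mcoeff mone]. *)
Lemma subst0 (I J : choiceType) (f : {malg F[{fmonom I}]}) :
  subst (fun=> 0 : {malg F[{fmonom J}]}) f = (f@_mone)%:MP.
Proof.
rewrite -[f in LHS](subrK (f@_mone)%:MP) raddfD /= substC subst_eq0 ?add0r //.
move=> [[|i w]] w_supp; last by rewrite /word_eval big_cons mul0r.
rewrite -mcoeff_neq0 -[FMonom _]/(FMonom [::]) -fmoneE in w_supp.
by rewrite mcoeffB malgCK subrr eqxx in w_supp.
Qed.

Section WordMap.
Context (I J : choiceType) (g : I -> seq J).

Definition word_map (w : {fmonom I}) : {fmonom J} := FMonom (flatten (map g w)).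

Lemma word_evalU w :
  word_eval (fun i => << FMonom (g i) >> : {malg F[{fmonom J}]}) w
    = << word_map w >>.
Proof.
case: w => w; rewrite /word_eval /word_map /=.
elim: w => [|i w IHw]; first by rewrite big_nil -fmoneE.
rewrite big_cons IHw malgM_def fgmulUU mulr1; congr << _ >>.
by apply/eqP; rewrite fmP fmM.
Qed.

(** Only words of [f] with the same image as [w] can contribute to this coefficient, so injectivity
    is asked at [w] alone. The word [w] may lie outside the support. *)
Lemma mcoeff_subst_word_map f w :
    (forall u, u \in msupp f -> word_map u = word_map w -> u = w) ->
  (subst (fun i => << FMonom (g i) >>) f)@_(word_map w) = f@_w.
Proof.
move=> inj_w; rewrite substE raddf_sum /=.
under eq_big_seq => u u_f.
  rewrite word_evalU mcoeffZ mcoeffU1.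
  have -> : (word_map u == word_map w) = (u == w).
    by apply/eqP/eqP => [/(inj_w _ u_f)|->].
  over.
rewrite -[RHS](mulr1 _); case: (boolP (w \in msupp f)) => [w_f|w_f].
  rewrite (big_fsetD1 w) //= eqxx big_seq big1 ?addr0 // => u.
  by rewrite in_fsetD1 => /andP[/negPf-> _]; rewrite mulr0.
rewrite (mcoeff_outdom w_f) mul0r big_seq big1 // => u u_f.
by case: eqP => [uw|]; rewrite ?mulr0 // -uw u_f in w_f *.
Qed.

End WordMap.

Lemma subst_id (I : choiceType) (f : {malg F[{fmonom I}]}) :
  subst (fun i => << fmu i >>) f = f.
Proof.
under subst_ext => i do rewrite fmuE.
apply/malgP => w; have wordK u : word_map (fun i : I => [:: i]) u = u.
  by rewrite /word_map flatten_map1 map_id fmK.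
rewrite -[in LHS](wordK w) mcoeff_subst_word_map // => u _.
by rewrite !wordK.
Qed.

End Subst.

(** * Decoding words after replacing x_i by z_i^N *)

Section Blowup.
Context (I : choiceType) (N : nat).
Implicit Types u w : seq (I + I)%type.

(** In the doubled alphabet, [inl i] stands for z_i and [inr i] for x_i. *)
Definition blowup (a : I + I) : seq I :=
  match a with inl i => [:: i] | inr i => nseq N i end.

Definition is_inr (a : I + I) : bool := if a is inr _ then true else false.

Lemma size_blowup w :
  size (flatten (map blowup w)) =
    (count is_inr w * N + count (predC is_inr) w)%N.
Proof.
elim: w => //= a w IHw; rewrite size_cat {}IHw.
by case: a => i /=; [rewrite addnCA | rewrite size_nseq mulSn addnA].
Qed.

(** The image of [w] has length divisible by N, while that of [u] has length congruent to its number
    of Z-letters, which is below N and hence zero. Both words are then read off in blocks of N equal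
    letters. *)
Lemma blowup_inj_in u w :
    (size u < N)%N -> all is_inr w ->
  flatten (map blowup u) = flatten (map blowup w) -> u = w.
Proof.
move=> lt_uN w_inr uw; have N_gt0 := leq_ltn_trans (leq0n _) lt_uN.
have {lt_uN} u_inr : all is_inr u.
  have /eqP w0 : count (predC is_inr) w == 0%N.
    by rewrite -leqn0 leqNgt -has_count has_predC negbK.
  have := congr1 (fun s => size s %% N)%N uw; rewrite !size_blowup w0 addn0.
  rewrite modnMDl modnMl modn_small; last first.
    exact: leq_ltn_trans (count_size _ _) lt_uN.
  by move/eqP; rewrite -leqn0 leqNgt -has_count has_predC negbK.
elim: u w u_inr w_inr uw => [|[//|i] u IHu] [|[//|j] w] //= u_inr w_inr.
(* A nonempty word in X could have an empty image only if N were 0. *)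
- by case: N N_gt0.
- by case: N N_gt0.
move/eqP; rewrite eqseq_cat ?size_nseq // => /andP[ij /eqP/IHu->] //.
by case: N N_gt0 ij => //= k _ /eqP[->].
Qed.

End Blowup.

Theorem theorem2 (F : fieldType) (n : nat) (f : {ncpoly F[n]})
    (C : circuit n {ncpoly F[n]}) :
  (forall r : 'I_n -> {ncpoly F[n]}, circuit_fun C r = ncsubst f r) ->
  exists C' : circuit n F,
    [/\ circuit_poly C' = f,
        num_sums C' = num_sums C,
        num_prods C' = num_prods C,
        circuit_size C' = circuit_size C
      & circuit_depth C' = circuit_depth C].
Proof.
move=> Cf; exists (map_circuit (mcoeff mone) C); split; last first.
- exact: circuit_depth_map.
- exact: circuit_size_map.
- exact: num_prods_map.
- exact: num_sums_map.
pose Z i : {malg F[{fmonom ('I_n + 'I_n)%type}]} := << fmu (inl i) >>.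
pose X i : {malg F[{fmonom ('I_n + 'I_n)%type}]} := << fmu (inr i) >>.
pose P := eval (subst Z) X (output C).
pose D := P - subst X f.
have D0 r : subst (fun a => match a with inl i => << fmu i >> | inr i => r i end)
    D = 0 :> {ncpoly F[n]}.
  (* Being a ring homomorphism, the substitution passes through the gates and sends P to the value
     of the circuit at r, where the hypothesis applies. *)
  rewrite raddfB /= rmorph_eval subst_comp.
  rewrite (subst_ext _ (s := r)) => [|i]; last by rewrite /= substX.
  rewrite -[subst r f]/(ncsubst f r) -Cf; apply/eqP; rewrite subr_eq0; apply/eqP.
  apply: eq_eval => [c|i] /=; last by rewrite substX.
  (* A constant embedded into F<Z, X> returns unchanged, since each z_i is sent to z_i. *)
  rewrite subst_comp -[RHS]subst_id; apply: subst_ext => i.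
  by rewrite /= substX.
(* [mmeasure] takes the maximum of the successors of the lengths, so each word of D is strictly
   shorter than N. *)
pose N := mmeasure (@fdeg ('I_n + 'I_n)%type) D.
have D_inr w : w \in msupp D -> ~~ all (@is_inr 'I_n) w.
  move=> w_D; apply/negP => w_inr; move: (w_D); rewrite -mcoeff_neq0.
  (* The coefficient of [w] in D reappears as a coefficient of the blown-up D, which is zero by
     [D0]. *)
  rewrite -(mcoeff_subst_word_map (g := @blowup 'I_n N)) => [|u u_D [] uw].
    rewrite (subst_ext _ (s := fun a => match a with
      inl i => << fmu i >> | inr i => << FMonom (nseq N i) >> end)).
      by rewrite D0 mcoeff0 eqxx.
    by case=> i //=; rewrite fmuE.
  apply/eqP; rewrite fmP; apply/eqP; apply: (blowup_inj_in _ w_inr uw).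
  exact: mmeasure_mnm_lt u_D.
pose X0 (a : ('I_n + 'I_n)%type) : {ncpoly F[n]} :=
  match a with inl _ => 0 | inr i => << fmu i >> end.
(* By [D_inr], each word of D contains a Z-letter, which [X0] kills. *)
have : subst X0 D = 0.
  apply: subst_eq0 => -[w] /D_inr; rewrite /word_eval /=.
  elim: w => //= -[i|i] w IHw; rewrite big_cons /= ?mul0r //.
  by move/IHw->; rewrite mulr0.
rewrite raddfB /= rmorph_eval subst_comp.
rewrite (subst_ext _ (s := fun i => << fmu i >>)) => [|i]; last exact: substX.
rewrite subst_id => /eqP; rewrite subr_eq0 => /eqP <-.
rewrite /circuit_poly eval_map; apply: eq_eval => [c|i] /=; last first.
  by rewrite substX.
(* On constants, the embedding [Z] followed by [X0] sends every variable to 0, leaving the constant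
   term. *)
rewrite subst_comp -(@subst0 _ 'I_n 'I_n); apply: subst_ext => i.
by rewrite /= substX.
Qed.
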